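(* Let $H=(V,\Delta)$ be a 3-graph such that $|V|$ is odd and every pair of distinct vertices is contained in at least one triple of $H$. Then $H$ has a spanning tree.
   Context: A 3-graph is $H=(V,\Delta)$ with $V$ finite and $\Delta\subseteq\binom V3$ (triples). A cycle in $H$ is a sequence $a_0,t_1,a_1,\dots,a_{\ell-1},t_\ell,a_\ell=a_0$ with $\ell\ge2$, $a_0,\dots,a_{\ell-1}$ distinct vertices, $t_1,\dots,t_\ell$ distinct triples, and $a_{i-1},a_i\in t_i$. A spanning tree is a set $T\subseteq\Delta$ containing no cycle, with $\bigcup T=V$, such that any two vertices are joined by a path $a_0,t_1,a_1,\dots,t_\ell,a_\ell$ of distinct vertices and distinct triples of $T$ with $a_{i-1},a_i\in t_i$.
   Formalization: The vertex set is assumed to have more than one element: if |V| = 1 there are no triples, so the union of T is empty and cannot equal V, and no spanning tree exists under the stated definition. *)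

(* Defs.v *)
From mathcomp Require Import all_boot.

Set Implicit Arguments.
Unset Strict Implicit.
Unset Printing Implicit Defensive.

(* A 3-graph is a finType V of vertices together with a set D of triples.     *)
Definition three_graph (V : finType) (D : {set {set V}}) : Prop :=
  forall t : {set V}, t \in D -> #|t| = 3.

(* The vertices are a_0, ..., a_(l-1), and [t i] is the triple t_(i+1) that   *)
(* contains a_i and a_(i+1); the index i+1 is taken modulo l (ordS), so that  *)
(* a_l = a_0.                                                                 *)
Definition is_cycle (V : finType) (T : {set {set V}}) (l : nat)
    (a : 'I_l -> V) (t : 'I_l -> {set V}) : Prop :=
  [/\ 2 <= l, injective a, injective t, (forall i : 'I_l, t i \in T)
    & forall i : 'I_l, (a i \in t i) && (a (ordS i) \in t i)].

(* The vertices are a_0, ..., a_l, and [t i] is the triple t_(i+1) that       *)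
(* contains a_i = a (widen_ord (leqnSn l) i) and a_(i+1) = a (lift ord0 i).   *)
(* The case l = 0 is the trivial path from a vertex to itself.                *)
Definition is_path (V : finType) (T : {set {set V}}) (l : nat)
    (a : 'I_l.+1 -> V) (t : 'I_l -> {set V}) : Prop :=
  [/\ injective a, injective t, (forall i : 'I_l, t i \in T)
    & forall i : 'I_l,
        (a (widen_ord (leqnSn l) i) \in t i) && (a (lift ord0 i) \in t i)].

Definition acyclic (V : finType) (T : {set {set V}}) : Prop :=
  forall (l : nat) (a : 'I_l -> V) (t : 'I_l -> {set V}), ~ is_cycle T a t.

Definition joined (V : finType) (T : {set {set V}}) (x y : V) : Prop :=
  exists (l : nat) (a : 'I_l.+1 -> V) (t : 'I_l -> {set V}),
    [/\ is_path T a t, a ord0 = x & a ord_max = y].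

Definition spanning_tree (V : finType) (D T : {set {set V}}) : Prop :=
  [/\ T \subset D, acyclic T, cover T = [set: V]
    & forall x y : V, joined T x y].

(* Main.v *)
Require Import Defs.
From mathcomp Require Import all_boot.
From mathcomp Require Import zify.
From Stdlib Require Import Classical_Prop.

(**
Call a vertex set grown if it arises from a single vertex by repeatedly adding
two new vertices [q], [q'] along a triple [{p, q, q'}] with [p] already present;
the triples used form a tree, and the set has odd size.  Let [S] be a largest
grown set and suppose [r] lies outside [S].  By maximality, a triple through
[r] and a vertex of [S] has its third vertex in [S].  Some [x] in [S] can then be
exchanged for [r], i.e. [S - x + r] is grown: undo the last step [{p, q, q'}].
If some triple [{s, q, r}] has [s] in the smaller set, growing along it instead
gives [S - q' + r], and symmetrically for [q'].  Otherwise [{r, q, q'}] is a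
triple and the smaller set satisfies the same hypotheses; exchange some [x] for
[r] in it, then grow along [{r, q, q'}].  A one-vertex set does not occur, as
its vertex would need a partner in it.
By parity there is a second vertex [r' != r] outside [S]; a triple through [x]
and [r'] has its third vertex in [S], hence in [S - x + r], and can be used to
enlarge [S - x + r], contradicting maximality.
*)

Set Implicit Arguments.
Unset Strict Implicit.
Unset Printing Implicit Defensive.

(** * Paths: reversal and extension by a new first vertex *)

Section Joining.

Variable V : finType.
Implicit Types (T : {set {set V}}) (S t : {set V}) (x y : V).

Lemma joined_refl T x : joined T x x.
Proof.
exists 0, (fun=> x), (fun=> set0); split=> //.
by split=> [i j _|[]|[]|[]] //; rewrite !ord1.
Qed.

Lemma joined_sub T T' x y : T \subset T' -> joined T x y -> joined T' x y.
Proof.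
move=> sTT' [l [a [t [[inja injt tT at_] ax ay]]]].
by exists l, a, t; split=> //; split=> // i; apply: (subsetP sTT').
Qed.

Lemma joined_sym T x y : joined T x y -> joined T y x.
Proof.
move=> [l [a [t [[inja injt tT at_] ax ay]]]].
exists l, (a \o @rev_ord _), (t \o @rev_ord _); split=> /=.
- split=> [||i|i] //=;
    [exact: inj_comp inja rev_ord_inj|exact: inj_comp injt rev_ord_inj|].
  rewrite andbC; move: (at_ (rev_ord i)).
  have -> : widen_ord (leqnSn l) (rev_ord i) = rev_ord (lift ord0 i).
    by apply: val_inj => /=; rewrite /bump /=; lia.
  have -> // : lift ord0 (rev_ord i) = rev_ord (widen_ord (leqnSn l) i).
  by apply: val_inj => /=; rewrite /bump /=; have := ltn_ord i; lia.
- by rewrite -ay; congr a; apply: val_inj => /=; lia.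
- by rewrite -ax; congr a; apply: val_inj => /=; lia.
Qed.

(** The path starts in [S], and each later vertex lies in a triple of [T], hence in [S]. So [q] and
    [t0] are new to it. *)
Lemma joined_prepend T S t0 q x y :
    (forall t, t \in T -> t \subset S) -> q \notin S -> t0 \notin T ->
    x \in S -> q \in t0 -> x \in t0 ->
  joined T x y -> joined (t0 |: T) q y.
Proof.
move=> TS qS t0T xS qt0 xt0 [l [a [t [[inja injt tT at_] ax ay]]]].
have aS i : a i \in S.
  case: (unliftP ord0 i) => [j ->|->]; last by rewrite ax.
  by case/andP: (at_ j) => _; apply: (subsetP (TS _ (tT j))).
have aq i : a i <> q by move=> aiq; move: qS; rewrite -aiq aS.
have t0P i : t i <> t0 by move=> tit; move: t0T; rewrite -tit tT.
exists l.+1, (fun i => if unlift ord0 i is Some j then a j else q),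
  (fun i => if unlift ord0 i is Some j then t j else t0).
split; [split| |].
- move=> i j; case: unliftP => [i'|] ->; case: unliftP => [j'|] -> //.
  + by move/inja->.
  + by move/aq.
  + by move/esym/aq.
- move=> i j; case: unliftP => [i'|] ->; case: unliftP => [j'|] -> //.
  + by move/injt->.
  + by move/t0P.
  + by move/esym/t0P.
- by move=> i; case: unliftP => [j|] _; rewrite !inE ?eqxx ?tT ?orbT.
- move=> i; rewrite liftK; case: (unliftP ord0 i) => [j|] ->.
    have -> : widen_ord (leqnSn l.+1) (lift ord0 j) =
              lift ord0 (widen_ord (leqnSn l) j) by apply: val_inj.
    by rewrite liftK.
  have -> : widen_ord (leqnSn l.+1) ord0 = ord0 by apply: val_inj.
  by rewrite unlift_none qt0 ax.
- by rewrite unlift_none.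
- have -> : ord_max = lift ord0 (@ord_max l) by apply: val_inj.
  by rewrite liftK.
Qed.

End Joining.

(** * Grown sets: exchange of a vertex, and their trees *)

Section Growing.

Variables (V : finType) (D : {set {set V}}).
Implicit Types (S T : {set V}) (p q r s x y : V).

Inductive grown : {set V} -> Prop :=
| grown1 v : grown [set v]
| grownU S p q q' : grown S -> p \in S -> q \notin S -> q' \notin S ->
    q != q' -> [set p; q; q'] \in D -> grown (S :|: [set q; q']).

Lemma card_grownU S q q' : q \notin S -> q' \notin S -> q != q' ->
  #|S :|: [set q; q']| = #|S|.+2.
Proof.
move=> qS q'S qq'; rewrite cardsU cards2 qq' (_ : S :&: _ = set0) ?cards0 ?subn0 ?addn2 //.
apply/setP=> z; rewrite !inE; case: eqP => [->|_]; first by rewrite (negPf qS).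
by case: eqP => [->|_]; rewrite ?andbF // (negPf q'S).
Qed.

Lemma odd_grown S : grown S -> odd #|S|.
Proof.
elim=> [v|{}S p q q' _ IH _ qS q'S qq' _]; first by rewrite cards1.
by rewrite card_grownU //= negbK.
Qed.

Lemma grown_exchange S r : grown S -> r \notin S ->
    (forall s, s \in S -> exists s', [/\ s' \in S, s != s' & [set s; s'; r] \in D]) ->
  exists2 x, x \in S & grown (r |: S :\ x).
Proof.
move=> gS; elim: gS => [v|{}S p q q' gS IH pS qS q'S qq' pD].
  move=> _ /(_ v (set11 v)) [s' [/set1P-> ]]; by rewrite eqxx.
rewrite !inE !negb_or => /and3P[rS rq rq'] link.
(* Stated for [u] and [u'] so as to serve both orders of [q] and [q']. *)
have swap u u' : u \notin S -> u' \notin S -> u != u' -> r != u -> r != u' ->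
    (exists2 s, s \in S & [set s; u; r] \in D) -> grown (r |: (S :|: [set u; u']) :\ u').
  move=> uS u'S uu' ru ru' [s sS sD].
  suff <- : S :|: [set u; r] = r |: (S :|: [set u; u']) :\ u'.
    by apply: (grownU gS sS) => //; rewrite eq_sym.
  apply/setP=> z; rewrite !inE.
  case: (eqVneq z u') => [->|_] /=; last by case: (z == r); rewrite ?orbT ?orbF.
  by rewrite (negPf u'S) eq_sym (negPf uu') eq_sym (negPf ru').
have [/exists_inP ex|/exists_inPn noq] := boolP [exists s in S, [set s; q; r] \in D].
  by exists q'; [rewrite !inE eqxx !orbT|apply: swap].
have [/exists_inP ex|/exists_inPn noq'] := boolP [exists s in S, [set s; q'; r] \in D].
  exists q; first by rewrite !inE eqxx !orbT.
  by rewrite [[set q; q']]setUC; apply: swap; rewrite // eq_sym.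
have qq'r : [set r; q; q'] \in D.
  have [|s [sSq qs sD]] := link q; first by rewrite !inE eqxx orbT.
  move: sSq; rewrite !inE => /or3P[sS|/eqP sq|/eqP sq'].
  - by case/negP: (noq s sS); rewrite [[set s; q]]setUC.
  - by rewrite sq eqxx in qs.
  - by rewrite -setUA setUC -sq'.
(* By [noq] and [noq'], the partner of a vertex of [S] is neither [q] nor [q'], so it stays in
   [S]. *)
have [//|s sS|x xS gx] := IH.
  have [|s' [s'Sq ss' sD]] := link s; first by rewrite !inE sS.
  move: s'Sq; rewrite !inE => /or3P[s'S|/eqP sq|/eqP sq'].
  - by exists s'.
  - by case/negP: (noq s sS); rewrite -sq.
  - by case/negP: (noq' s sS); rewrite -sq'.
exists x; first by rewrite inE xS.
have xq : q != x by apply: contraNneq qS => ->.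
have xq' : q' != x by apply: contraNneq q'S => ->.
suff -> : r |: (S :|: [set q; q']) :\ x = (r |: S :\ x) :|: [set q; q'].
  apply: (grownU (p := r) gx) => //; first by rewrite !inE eqxx.
  - by rewrite !inE (negPf qS) andbF orbF eq_sym.
  - by rewrite !inE (negPf q'S) andbF orbF eq_sym.
apply/setP=> z; rewrite !inE.
case: (eqVneq z q) => [->|_]; first by rewrite xq !orbT.
by case: (eqVneq z q') => [->|_]; rewrite ?xq' ?orbT ?orbF.
Qed.

Lemma grown_tree S : grown S ->
  exists T : {set {set V}}, [/\ T \subset D, acyclic T,
    forall t, t \in T -> t \subset S
    & forall x y, x \in S -> y \in S -> joined T x y].
Proof.
elim=> [v|{}S p q q' _ [T [TD acT TS jT]] pS qS q'S qq' pD].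
  exists set0; split=> [||t|x y /set1P-> /set1P->].
  - exact: sub0set.
  - by move=> [|l] a t [] // _ _ _ /(_ ord0); rewrite inE.
  - by rewrite inE.
  - exact: joined_refl.
pose t0 := [set p; q; q'].
have t0T : t0 \notin T.
  by apply: contra qS => /TS /subsetP; apply; rewrite !inE eqxx orbT.
exists (t0 |: T); split.
- by rewrite subUset sub1set pD.
- move=> l a t [l2 inja injt tT at_].
  have [/existsP[i /eqP ti]|/existsPn not0] := boolP [exists i, t i == t0]; last first.
    apply: (acT l a t); split=> // i.
    by move: (tT i); rewrite !inE (negPf (not0 i)).
  have ordS_neq j : ordS j != j :> 'I_l.
    apply/eqP => /(congr1 val) /=; have := ltn_ord j.
    rewrite leq_eqVlt => /predU1P[jl|jl]; last by rewrite modn_small //; lia.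
    by rewrite jl modnn; lia.
  (* A vertex of the cycle lies in two distinct triples of the cycle, one of
     which is not [t0] and so is contained in [S]. *)
  have aS j : a j \in S.
    have [tj|ntj] := eqVneq (t j) t0.
      have tpj : t (ord_pred j) != t0.
        rewrite -tj; apply: contraNneq (ordS_neq (ord_pred j)) => /injt E.
        by rewrite ord_predK E.
      have := tT (ord_pred j); rewrite !inE (negPf tpj) => /TS /subsetP; apply.
      by have /andP[_] := at_ (ord_pred j); rewrite ord_predK.
    have := tT j; rewrite !inE (negPf ntj) => /TS /subsetP; apply.
    by have /andP[] := at_ j.
  (* As [t0] meets [S] only in [p], the distinct cycle vertices [a i] and [a (ordS i)], both in [S]
     and [t0], would coincide. *)
  have t0S z : z \in S -> z \in t0 -> z = p.
    move=> zS; rewrite !inE -orbA => /or3P[/eqP//|/eqP zq|/eqP zq].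
      by rewrite zq (negPf qS) in zS.
    by rewrite zq (negPf q'S) in zS.
  have /andP[ai aSi] := at_ i; rewrite ti in ai aSi.
  case/eqP: (ordS_neq i); apply: inja.
  by rewrite (t0S _ (aS i) ai) (t0S _ (aS (ordS i)) aSi).
- move=> t /setU1P[->|/TS tS]; last exact: subset_trans tS (subsetUl _ _).
  by rewrite /t0 -setUA setSU // sub1set.
have TT' : T \subset t0 |: T by apply: subsetUr.
have pre x y : x \in [set q; q'] -> y \in S -> joined (t0 |: T) x y.
  move=> xq yS; have xS : x \notin S by case/set2P: xq => ->.
  apply: (joined_prepend TS xS t0T pS); last exact: jT.
  - by rewrite /t0 -setUA inE xq orbT.
  - by rewrite !inE eqxx.
(* This path uses [t0] alone: it extends the trivial path at [q'] over the empty set of triples. *)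
have qq'j : joined (t0 |: T) q q'.
  apply: (joined_sub (setUS _ (sub0set T))).
  apply: (@joined_prepend _ set0 [set q'] _ _ q'); rewrite ?inE ?eqxx ?orbT //.
  - by move=> t; rewrite inE.
  - exact: joined_refl.
move=> x y /setUP[xS|xq] /setUP[yS|yq].
- exact: joined_sub TT' (jT _ _ xS yS).
- exact/joined_sym/pre.
- exact: pre.
- case/set2P: xq => ->; case/set2P: yq => -> //; try exact: joined_refl.
  exact: joined_sym.
Qed.

End Growing.

(** * Third vertices of triples, and maximal grown sets *)

Lemma triple_third (V : finType) (t : {set V}) x y :
  #|t| = 3 -> x != y -> x \in t -> y \in t ->
  exists z, [/\ t = [set x; y; z], x != z & y != z].
Proof.
move=> t3 xy xt yt.
have /cards1P[z zE] : #|t :\ x :\ y| == 1.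
  have := cardsD1 x t; have := cardsD1 y (t :\ x).
  by rewrite t3 xt !inE eq_sym xy yt; lia.
have : z \in t :\ x :\ y by rewrite zE set11.
rewrite !inE => /and3P[zy zx _]; exists z; split; rewrite 1?eq_sym //.
by rewrite -[t](setD1K xt) -[t :\ x](@setD1K _ y) ?zE ?setUA // !inE eq_sym xy.
Qed.

(** Otherwise growing along the triple would add two vertices. This serves both a largest grown set
    and the equally large set obtained from it by an exchange. *)
Lemma grown_max_third (V : finType) (D : {set {set V}}) (S : {set V}) s r y :
    (forall S', grown D S' -> #|S'| <= #|S|) -> grown D S ->
    s \in S -> r \notin S -> r != y -> [set s; r; y] \in D ->
  y \in S.
Proof.
move=> maxS gS sS rS ry tD; apply: contraT => yS.
by have := maxS _ (grownU gS sS rS yS ry tD); rewrite card_grownU // ltnNge leqnSn.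
Qed.

Theorem theorem3p3 (V : finType) (D : {set {set V}})
    (hD : three_graph D)
    (hodd : odd #|V|)
    (hnontriv : 1 < #|V|)
    (hpair : forall x y : V, x != y ->
       exists2 t : {set V}, t \in D & (x \in t) && (y \in t)) :
  exists T : {set {set V}}, spanning_tree D T.
Proof.
have third x y : x != y -> exists z, [/\ [set x; y; z] \in D, x != z & y != z].
  move=> xy; have [t tD /andP[xt yt]] := hpair x y xy.
  by have [z [tE xz yz]] := triple_third (hD _ tD) xy xt yt; exists z; rewrite -tE.
have [S [gS maxS]] : exists S, grown D S /\ forall S', grown D S' -> #|S'| <= #|S|.
  have [v _] : exists v : V, v \in V by apply/card_gt0P; apply: ltnW.
  (* Pass to a larger grown set while there is one; the number of vertices outside decreases. *)
  have [n] := ubnP (#|V| - #|[set v]|); elim: n [set v] (grown1 D v) => // n IH S gS ltn.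
  have [[S' gS' ltS]|noS] := classic (exists2 S', grown D S' & #|S| < #|S'|).
    by apply: IH gS' _; have : #|S'| <= #|V| := max_card _; lia.
  exists S; split=> // S' gS'; rewrite leqNgt; apply/negP => ?; apply: noS.
  by exists S'.
have ST : S = setT.
  apply/eqP; rewrite -subTset; apply/subsetPn => -[r _ rS].
  have [x xS gS'] : exists2 x, x \in S & grown D (r |: S :\ x).
    apply: grown_exchange => // s sS.
    have sr : s != r by apply: contraNneq rS => <-.
    have [y [tD sy ry]] := third s r sr.
    exists y; split=> //; first exact: grown_max_third tD.
    by rewrite -setUA [[set y; r]]setUC setUA.
  have cS' : #|r |: S :\ x| = #|S|.
    by rewrite cardsU1 !inE (negPf rS) andbF (cardsD1 x S) xS.
  have [r' r'S rr'] : exists2 r', r' \notin S & r != r'.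
    (* Both [V] and [S] have odd size, so the complement of [S] has even size and cannot be just
       [r]. *)
    have: 0 < #|~: S :\ r|.
      have := cardsC S; have := cardsD1 r (~: S); have := odd_grown gS.
      by rewrite inE rS; lia.
    by case/card_gt0P => r'; rewrite !inE eq_sym => /andP[? ?]; exists r'.
  have xr' : x != r' by apply: contraNneq r'S => <-.
  have [y [tD xy r'y]] := third x r' xr'.
  have yS : y \in S by apply: grown_max_third tD.
  (* The exchanged set is also of maximal size and contains [y], so the triple through [y], [r'] and
     [x] forces the removed vertex [x] back into it. *)
  suff : x \in r |: S :\ x.
    by rewrite !inE eqxx orbF => /eqP xr; rewrite -xr xS in rS.
  apply: (@grown_max_third _ D _ y r' x) => //; rewrite ?cS' ?inE //.
  - by rewrite yS (eq_sym y x) xy orbT.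
  - by rewrite (negPf r'S) andbF orbF eq_sym.
  - by rewrite eq_sym.
  - by rewrite -setUA [[set r'; x]]setUC setUC.
have [T [TD acT _ jT]] := grown_tree gS; exists T; split=> // [|x y]; last first.
  by apply: jT; rewrite ST inE.
apply/setP=> x; rewrite inE.
(* A path from [x] to another vertex is nontrivial, so its first triple covers [x]. *)
have [y] : exists y, y \in [set~ x] by apply/card_gt0P; rewrite cardsC1; lia.
rewrite !inE => yx.
have [||[|l] [a [t [[_ _ tT at_] ax ay]]]] := jT x y; rewrite ?ST ?inE //.
  by rewrite -ax -ay (ord1 ord_max) eqxx in yx.
apply/bigcupP; exists (t ord0); first exact: tT.
have /andP[+ _] := at_ ord0; rewrite -ax.
by have -> : widen_ord (leqnSn l.+1) ord0 = ord0 by apply: val_inj.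
Qed.
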